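(* Let $X$ be a locally compact, separable, completely metrizable topological space. Let $\mathcal{U}$ be a compact set (in the topology of compact convergence) of continuous utility functions $u:X\to\mathbb{R}$, and suppose every preference in $\Phi(\mathcal{U})=\{\Phi(u):u\in\mathcal{U}\}$ is locally strict. Then the class of preferences $\mathcal{P}\equiv\Phi(\mathcal{U})$ is a closed set (in the closed convergence topology) of locally strict preferences.
   Context: A preference on $X$ is a complete binary relation on $X$ that is closed as a subset of $X\times X$. $x\succ y$ means $x\succeq y$ and not $y\succeq x$. $\succeq$ is locally strict if for all $x\succeq y$ and every neighborhood $V$ of $(x,y)$ in $X\times X$ there is $(x',y')\in V$ with $x'\succ y'$. For $u:X\to\mathbb{R}$, $\Phi(u)$ is the relation defined by $x\mathrel{\Phi(u)}y$ iff $u(x)\ge u(y)$. The topology of compact convergence on functions $X\to\mathbb R$ is that of uniform convergence on every compact subset of $X$. Closed convergence: $\succeq_n\to\succeq^*$ means (1) for all $x^*\succeq^* y^*$ there are $(x_n,y_n)\to(x^*,y^* )$ with $x_n\succeq_n y_n$ for all $n$; and (2) for every subsequence $\{\succeq_{n_k}\}_k$ and every limit $(x^*,y^* )$ of pairs with $x_{n_k}\succeq_{n_k}y_{n_k}$ for all $k$, $x^*\succeq^*y^*$. For $X$ as in the claim, this is convergence in the metrizable closed convergence topology on continuous binary relations (closed subsets of $X\times X$). *)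

(* Defs.v *)
From HB Require Import structures.
From mathcomp Require Import all_boot all_order all_algebra. 
From mathcomp Require Import finmap.
From mathcomp Require Import all_classical all_reals all_analysis.

Set Implicit Arguments.
Unset Strict Implicit.
Unset Printing Implicit Defensive.

Import Order.TTheory GRing.Theory Num.Theory.
Import numFieldNormedType.Exports.

Local Open Scope classical_set_scope.
Local Open Scope ring_scope.

Definition separable (T : topologicalType) :=
  exists2 S : set T, countable S & dense S.

Record is_metric_for (R : realType) (T : topologicalType) (d : T -> T -> R) :
    Prop := {
  dist_eq0 : forall x y, d x y = 0 <-> x = y ;
  dist_sym : forall x y, d x y = d y x ;
  dist_triangle : forall y x z, d x z <= d x y + d y z ;
  dist_nbhs : forall x (A : set T),
    nbhs x A <-> exists2 e : R, 0 < e & [set y | d x y < e] `<=` A }.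

Definition complete_dist (R : realType) (T : topologicalType)
    (d : T -> T -> R) :=
  forall s : nat -> T,
    (forall e : R, 0 < e -> exists N, forall m n,
       (N <= m)%N -> (N <= n)%N -> d (s m) (s n) < e) ->
    exists x : T, s n @[n --> \oo] --> x.

(* Stated as a property of the topology: the library's complete pseudometric
   types carry a fixed pseudometric and a base point, so that they also exclude
   the empty space. *)
Definition completely_metrizable (R : realType) (T : topologicalType) :=
  exists2 d : T -> T -> R, is_metric_for d & complete_dist d.

(* A binary relation on X is the set of its pairs, [B (x, y)] being "x B y". *)

Definition complete_rel (X : Type) (B : set (X * X)) :=
  forall x y, B (x, y) \/ B (y, x).

Definition preference (X : topologicalType) (B : set (X * X)) :=
  complete_rel B /\ closed B.

Definition strict (X : Type) (B : set (X * X)) : set (X * X) :=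
  [set p | B (p.1, p.2) /\ ~ B (p.2, p.1)].

Definition locally_strict (X : topologicalType) (B : set (X * X)) :=
  forall x y, B (x, y) -> forall V : set (X * X), nbhs (x, y) V ->
    exists2 p, V p & strict B p.

Definition Phi (R : realType) (X : Type) (u : X -> R) : set (X * X) :=
  [set p | u p.1 >= u p.2].

(* The space of closed subsets of T, with the topology of closed convergence
   (Fell topology) generated by the sets of all F meeting a given open set and
   the sets of all F missing a given compact set.  Its convergent sequences are
   described in [closed_convergenceP]. *)
Definition closed_subsets (T : topologicalType) : Type :=
  {F : set T | closed F}.

Section closed_convergence_topology.
Variable T : topologicalType.

HB.instance Definition _ := gen_eqMixin (closed_subsets T).
HB.instance Definition _ := gen_choiceMixin (closed_subsets T).

Definition hit (G : set T) : set (closed_subsets T) :=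
  [set F | sval F `&` G !=set0].

Definition miss (K : set T) : set (closed_subsets T) :=
  [set F | sval F `&` K = set0].

Definition closed_convergence_subbase : set (set (closed_subsets T)) :=
  hit @` open `|` miss @` compact.

HB.instance Definition _ := isSubBaseTopological.Build (closed_subsets T)
  closed_convergence_subbase id.

End closed_convergence_topology.


Lemma closed_subsets_cvgP (T : topologicalType) (Fn : nat -> closed_subsets T)
    (F : closed_subsets T) :
  Fn n @[n --> \oo] --> F <->
  (forall G, open G -> hit G F -> \forall n \near \oo, hit G (Fn n)) /\
  (forall K, compact K -> miss K F -> \forall n \near \oo, miss K (Fn n)).
Proof.
have sub S : closed_convergence_subbase S -> S F -> nbhs F S.
  move=> bS SF; rewrite nbhsE; exists S => //; split => //.
  exists [set S]; last by rewrite bigcup_set1.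
  move=> _ ->; exists [fset S]%fset; first by move=> A /fset1P ->; exact/mem_set.
  by rewrite predeqE => x; split=> [/(_ S)|Sx A /fset1P -> //]; apply; exact/fset1P.
split=> [FnF|[FG FK] A].
  by split=> [G oG|K cK] SF; apply: FnF; apply: sub => //;
    [left; exists G|right; exists K].
rewrite nbhsE => -[_ [[E sE <-] [C EC CF]] sA].
apply: (filterS sA); apply: (@filterS _ _ _ C) => [x Cx|]; first by exists C.
have /sE[D sD DC] := EC; rewrite -DC; apply: filter_bigI => S DS.
have SF : S F by move: CF; rewrite -DC; apply.
have /sD := DS; rewrite inE => -[] [S' oS' SE]; move: SF; rewrite -SE => SF.
  exact: FG.
exact: FK.
Qed.

Lemma increasing_subsequence (P : nat -> nat -> Prop) :
  (forall m N, exists2 n, (N <= n)%N & P m n) ->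
  exists2 k : nat -> nat, {homo k : m n / (m < n)%N} & forall m, P m (k m).
Proof.
move=> PN; have {PN}/choice[f fP] : forall mN : nat * nat,
  exists n, (mN.2 <= n)%N /\ P mN.1 n by move=> [m N]; have [n] := PN m N; exists n.
pose k := fix k m := if m is m'.+1 then f (m, (k m').+1) else f (0, 0)%N.
exists k.
  apply: homo_ltn => [y x z|m]; first exact: ltn_trans.
  by have [] := fP (m.+1, (k m).+1).
by case=> [|m]; [have [] := fP (0, 0)%N|have [] := fP (m.+1, (k m).+1)].
Qed.

Definition closed_convergence (T : topologicalType) (Fn : nat -> set T)
    (F : set T) :=
  (forall z, F z -> exists2 w : nat -> T,
     w n @[n --> \oo] --> z & forall n, Fn n (w n)) /\
  (forall k : nat -> nat, {homo k : m n / (m < n)%N} ->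
   forall (w : nat -> T) (z : T), w n @[n --> \oo] --> z ->
     (forall n, Fn (k n) (w n)) -> F z).

Section closed_convergence_metric.
Context {R : realType} {T : topologicalType} {d : T -> T -> R}.
Hypothesis dP : is_metric_for d.
Hypothesis lcT : locally_compact [set: T].

Let B (z : T) (n : nat) := [set y | d z y < n.+1%:R^-1].

Let nbhs_B z n : nbhs z (B z n).
Proof. by apply/(dist_nbhs dP); exists n.+1%:R^-1 => //; rewrite invr_gt0. Qed.

Let B_decr z m n : (m <= n)%N -> B z n `<=` B z m.
Proof.
move=> mn y /lt_le_trans; apply.
by rewrite lef_pV2 ?posrE// ler_nat.
Qed.

Let B_basis z A : nbhs z A -> exists n, B z n `<=` A.
Proof.
move=> /(dist_nbhs dP)[e e0 eA]; exists (Num.truncn e^-1) => y By; apply: eA.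
rewrite /=; apply: (lt_trans By); rewrite -[ltRHS]invrK ltf_pV2 ?posrE ?invr_gt0//.
exact: truncnS_gt.
Qed.

Let B_cvg (w : nat -> T) z (N : nat -> nat) :
  (forall m n, (N m <= n)%N -> B z m (w n)) -> w n @[n --> \oo] --> z.
Proof.
move=> wB A /B_basis[m mA]; exists (N m) => // n /= Nn; exact/mA/wB.
Qed.

Let hausT : hausdorff_space T.
Proof.
move=> p q pq; apply/(dist_eq0 dP); apply: contrapT => /eqP dpq.
have d0 : 0 <= d p q.
  have := dist_triangle dP q p p.
  rewrite (proj2 (dist_eq0 dP p p) erefl) -(dist_sym dP p q) -mulr2n.
  by rewrite pmulrn_lge0.
have {}d0 : 0 < d p q by rewrite lt_neqAle d0 andbT eq_sym.
have h e x : 0 < e -> nbhs x [set y | d x y < e].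
  by move=> e0; apply/(dist_nbhs dP); exists e.
have e0 : 0 < d p q / 2 by rewrite divr_gt0.
have [y [/= py qy]] := pq _ _ (h _ p e0) (h _ q e0).
have := dist_triangle dP y p q; rewrite leNgt => /negP; apply.
by rewrite [ltRHS]splitr ltrD// (dist_sym dP).
Qed.

Let compact_nbhs (z : T) (A : set T) : nbhs z A ->
  exists K, [/\ nbhs z K, compact K & K `<=` A].
Proof.
move=> zA; have [K zK [cK clK]] := @lcT z I.
have {}zK : nbhs z K.
  by move: zK; rewrite /within/=; apply: filterS => x; exact.
have [U zU UA] := compact_regular hausT cK zK zA.
exists (K `&` closure U); split.
- by apply: filterI => //; apply: filterS zU; exact: subset_closure.
- by apply: compact_closedI => //; exact: closed_closure.
- by move=> x [_ /UA].
Qed.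

Lemma closed_convergence_metricP (Fn : nat -> closed_subsets T)
    (F : closed_subsets T) : (forall n, sval (Fn n) !=set0) ->
  Fn n @[n --> \oo] --> F <->
  closed_convergence (fun n => sval (Fn n)) (sval F).
Proof.
move=> Fn0; rewrite closed_subsets_cvgP; split=> [[FG FK]|[F1 F2]]; split.
- move=> z Fz.
  have near_pt n j : exists x, sval (Fn n) x /\
      forall m, (m < j)%N -> sval (Fn n) `&` B z m !=set0 -> B z m x.
    elim: j => [|j [x [Fx xB]]]; first by have [x] := Fn0 n; exists x.
    have [[y [Fy By]]|nB] := pselect (sval (Fn n) `&` B z j !=set0).
      exists y; split => // m; rewrite ltnS => mj _; exact: (B_decr mj).
    exists x; split => // m; rewrite ltnS leq_eqVlt => /predU1P[->//|].
    exact: xB.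
  have /choice[w wP] := fun n => near_pt n n.+1.
  exists w; last by move=> n; have [] := wP n.
  have /choice[N NP] : forall m, exists N, forall n, (N <= n)%N ->
      sval (Fn n) `&` B z m !=set0.
    move=> m; have [|N _ NP] := FG (interior (B z m)) (open_interior _).
      by exists z; split => //; exact: nbhs_B.
    exists N => n /NP[x [Fx /interior_subset Bx]]; by exists x.
  apply: (@B_cvg w z (fun m => maxn m (N m))) => m n.
  rewrite geq_max => /andP[mn Nn]; have [_] := wP n; apply; first by rewrite ltnS.
  exact: NP.
- move=> k k_incr w z wz wF; apply: contrapT => Fz.
  have [|K [zK cK KF]] := @compact_nbhs z (~` sval F).
    by apply: open_nbhs_nbhs; split => //; exact/closed_openC/(svalP F).
  have [|N _ NP] := FK K cK; first by rewrite /miss/= setIC; exact/disjoints_subset.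
  have [M _ MP] := wz _ zK.
  have le_k n : (n <= k n)%N.
    by elim: n => // n nk; apply: (leq_ltn_trans nk); exact: k_incr.
  have /seteqP[/(_ (w (maxn M N)))] := NP (k (maxn M N))
    (leq_trans (leq_maxr _ _) (le_k _)).
  by move=> + _; apply; split; [exact: wF|apply: MP; exact: leq_maxl].
- move=> G oG [z [Fz Gz]]; have [w wz wF] := F1 z Fz.
  have [|N _ NP] := wz G; first exact: open_nbhs_nbhs.
  by exists N => // n Nn; exists (w n); split => //; exact: NP.
- move=> K cK FK; apply: contrapT => notFK.
  have often (N : nat) : exists2 n, (N <= n)%N & sval (Fn n) `&` K !=set0.
    apply: contrapT => nN; apply: notFK; exists N => // n /= Nn.
    apply: contrapT => /eqP/set0P FnK; by apply: nN; exists n.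
  have [k k_incr kP] := increasing_subsequence (fun=> often).
  have /choice[w wP] := kP.
  have [|z [Kz zw]] := cK (w n @[n --> \oo]) _.
    by exists 0%N => // n _; have [] := wP n.
  have [m N|j j_incr jP] := @increasing_subsequence (fun m n => B z m (w n)).
    have [||_ [[n Nn <-] Bn]] := zw (w @` [set n | N <= n]%N) (B z m).
    + by exists N => // n Nn; exists n.
    + exact: nbhs_B.
    + by exists n.
  suff Fz : sval F z by move/seteqP: FK => [/(_ z) + _]; apply.
  apply: (F2 (k \o j) _ (w \o j)) => [m n /j_incr/k_incr//||n].
    by apply: (@B_cvg _ _ id) => m n mn; apply: (B_decr mn); exact: jP.
  by have [] := wP (j n).
Qed.

End closed_convergence_metric.

Lemma metric_prod (R : realType) (S T : topologicalType) (d : S -> S -> R)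
    (e : T -> T -> R) : is_metric_for d -> is_metric_for e ->
  is_metric_for (fun x y : S * T => d x.1 y.1 + e x.2 y.2).
Proof.
move=> dP eP.
have ge0 (Z : topologicalType) (f : Z -> Z -> R) : is_metric_for f ->
    forall x y, 0 <= f x y.
  move=> fP x y; have := dist_triangle fP y x x.
  rewrite (proj2 (dist_eq0 fP x x) erefl) (dist_sym fP y) -mulr2n.
  by rewrite pmulrn_lge0.
split=> [[x1 x2] [y1 y2]|x y|y x z|x A] /=.
- split=> [/eqP|[-> ->]].
    rewrite paddr_eq0 ?ge0// => /andP[/eqP/(dist_eq0 dP) -> /eqP].
    by move=> /(dist_eq0 eP) ->.
  by rewrite (proj2 (dist_eq0 dP _ _))// (proj2 (dist_eq0 eP _ _))// addr0.
- by rewrite (dist_sym dP) (dist_sym eP).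
- by rewrite addrACA lerD// ?(dist_triangle dP)// (dist_triangle eP).
- split=> [[[P Q] /= [/(dist_nbhs dP)[a a0 aP] /(dist_nbhs eP)[b b0 bQ]] PQA]|].
    exists (Num.min a b); first by rewrite lt_min a0.
    move=> y /=; rewrite lt_min => /andP[ya yb]; apply: PQA; split => /=.
      by apply: aP; apply: le_lt_trans ya; rewrite lerDl ge0.
    by apply: bQ; apply: le_lt_trans yb; rewrite lerDr ge0.
  case=> r r0 rA; have r20 : 0 < r / 2 by rewrite divr_gt0.
  exists ([set y | d x.1 y < r / 2], [set y | e x.2 y < r / 2]) => /=.
    by split; [apply/(dist_nbhs dP)|apply/(dist_nbhs eP)]; exists (r / 2).
  by move=> y [/= y1 y2]; apply: rA; rewrite /= [ltRHS]splitr ltrD.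
Qed.

(* The nonemptiness hypothesis only reflects that the first clause of
   [closed_convergence] asks for points for all n, not just for large n. *)
Lemma closed_convergenceP (R : realType) (X : topologicalType)
    (Bn : nat -> closed_subsets (X * X)%type)
    (B : closed_subsets (X * X)%type) :
  completely_metrizable R X -> locally_compact [set: X] ->
  (forall n, sval (Bn n) !=set0) ->
  Bn n @[n --> \oo] --> B <->
  closed_convergence (fun n => sval (Bn n)) (sval B).
Proof.
move=> [d dP _] lcX; apply: (closed_convergence_metricP (metric_prod dP dP)).
move=> [x y] _; have [K xK [cK clK]] := @lcX x I.
have [L yL [cL clL]] := @lcX y I.
exists (K `*` L); last first.
  split; first exact: compact_setX.
  by apply: (@closedI _ (fst @^-1` K) (snd @^-1` L));
    apply: preimage_closed => // p _; [exact: cvg_fst|exact: cvg_snd].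
exists (K, L) => /=; last by move=> p ? _.
by split; [move: xK|move: yL]; rewrite /within/=; apply: filterS => z; exact.
Qed.

(* Main.v *)
(** A relation B in the closure of Phi(U) is approximated by relations Phi(v)
    with v in U, and compactness of U gives a cluster point u of such utilities.
    If B relates x to y but u x < u y, then v a < v b for all (a, b) in a
    compact neighborhood of (x, y) once v is near u, so Phi(v) misses an open
    set that B hits.  If u y <= u x but B does not relate x to y, local
    strictness of Phi(u) provides a point (x', y') outside of B with
    u y' < u x', so that Phi(v) hits the compact set {(x', y')}, which B misses,
    once v is near u. *)
Require Import Defs.
From HB Require Import structures.
From mathcomp Require Import all_boot all_order all_algebra.
From mathcomp Require Import finmap lra.
From mathcomp Require Import all_classical all_reals all_analysis.

Import Order.TTheory GRing.Theory Num.Theory.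
Import numFieldNormedType.Exports.

Local Open Scope classical_set_scope.
Local Open Scope ring_scope.

(** A subbasic set is a basic open set, as the intersection of the singleton family containing
    it. *)
Lemma nbhs_closed_convergence_subbase (T : topologicalType)
    (F : closed_subsets T) (S : set (closed_subsets T)) :
  closed_convergence_subbase S -> S F -> nbhs F S.
Proof.
move=> bS SF; rewrite nbhsE; exists S => //; split => //.
exists [set S]; last by rewrite bigcup_set1.
move=> _ ->; exists [fset S]%fset; first by move=> A /fset1P ->; exact/mem_set.
by rewrite predeqE => x; split=> [/(_ S)|Sx A /fset1P -> //]; apply; exact/fset1P.
Qed.

Lemma nbhs_hit (T : topologicalType) (F : closed_subsets T) (G : set T) :
  open G -> hit G F -> nbhs F (hit G).
Proof. by move=> oG; apply: nbhs_closed_convergence_subbase; left; exists G. Qed.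

Lemma nbhs_miss (T : topologicalType) (F : closed_subsets T) (K : set T) :
  compact K -> miss K F -> nbhs F (miss K).
Proof. by move=> cK; apply: nbhs_closed_convergence_subbase; right; exists K. Qed.

Lemma locally_compact_nbhs (X : topologicalType) :
  locally_compact [set: X] -> forall x : X, exists2 K : set X, nbhs x K & compact K.
Proof.
move=> lcX x; have [K xK [cK _]] := lcX x I; exists K => //.
by move: xK; rewrite /within/=; apply: filterS => y; exact.
Qed.

Lemma nbhs_compact_convergence (R : realType) (X : topologicalType)
    (K : set X) (u : {family compact, X -> R}) (e : R) :
  compact K -> 0 < e -> nbhs u [set v | forall x, K x -> `|u x - v x| < e].
Proof.
move=> cK e0; have := @fam_nbhs _ _ compact K _ u
  (@entourage_ball R R (PosNum e0)) cK.
by apply: filterS => v uv x Kx; exact: uv.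
Qed.

(** Closedness holds because [Phi u] is the preimage of the nonnegative reals under the continuous
    map [u p.1 - u p.2]. *)
Lemma preference_Phi (R : realType) (X : topologicalType) (u : X -> R) :
  continuous u -> preference (Phi u).
Proof.
move=> cu; split; first by move=> x y; exact/orP/le_total.
have -> : Phi u = (fun p : X * X => u p.1 - u p.2) @^-1` [set r | 0 <= r].
  by apply/seteqP; split=> p; rewrite /Phi /= subr_ge0.
apply: preimage_closed; last exact: closed_ge.
move=> p _; apply: (@cvgB _ R^o).
  by apply: (@continuous_comp _ _ _ fst u); [exact: cvg_fst|exact: cu].
by apply: (@continuous_comp _ _ _ snd u); [exact: cvg_snd|exact: cu].
Qed.

(** The sets [E N] of utilities in [U] whose relation lies in [N], for [N] a neighborhood of [B],
    generate a filter. It is proper because [B] is in the closure, so it clusters at some [u] in the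
    compact set [U]. Filters take the place of sequences here. *)
Lemma closure_Phi_cluster (R : realType) (X : topologicalType)
    (U : set (X -> R)) (B : closed_subsets (X * X)%type) :
  compact (U : set {family compact, X -> R}) ->
  closure [set B : closed_subsets (X * X)%type | [set Phi u | u in U] (sval B)] B ->
  exists2 u, U u &
    forall (V : set {family compact, X -> R}) (N : set (closed_subsets (X * X)%type)),
    nbhs (u : {family compact, X -> R}) V -> nbhs B N ->
    exists v B', [/\ V v, N B' & sval B' = Phi v].
Proof.
move=> cU clB.
pose E (N : set (closed_subsets (X * X)%type)) : set {family compact, X -> R} :=
  [set u | U u /\ exists2 B', N B' & sval B' = Phi u].
have FF : ProperFilter (filter_from (nbhs B) E).
  apply: filter_from_proper; last first.
    by move=> N /clB[B' [[u Uu uB'] NB']]; exists u; split => //; exists B'.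
  apply: filter_from_filter; first by exists setT; exact: filterT.
  move=> M N MB NB; exists (M `&` N); first exact: filterI.
  by move=> u [Uu [B' [? ?] ?]]; split; split => //; exists B'.
have [|u [Uu clu]] := cU _ FF; first by exists setT; [exact: filterT|move=> u []].
exists u => // V N uV NB.
have [|v [[_ [B' NB' B'v]] Vv]] := clu (E N) V _ uV; first by exists N.
by exists v, B'.
Qed.

Theorem proposition1 (R : realType) (X : topologicalType)
    (X_locally_compact : locally_compact [set: X])
    (X_separable : separable X)
    (X_completely_metrizable : completely_metrizable R X)
    (U : set (X -> R))
    (U_compact : compact (U : set {family compact, X -> R}))
    (U_continuous : forall u, U u -> continuous u)
    (U_locally_strict : forall B, [set Phi u | u in U] B -> locally_strict B) :
  let P : set (set (X * X)) := [set Phi u | u in U] in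
  (forall B, P B -> preference B /\ locally_strict B) /\
  closed [set B : closed_subsets (X * X)%type | P (sval B)].
Proof.
move=> P; split=> [B PB|B clB].
  split; last exact: U_locally_strict.
  by case: PB => u /U_continuous cu <-; exact: preference_Phi.
have [u Uu clu] := closure_Phi_cluster _ _ _ _ U_compact clB.
exists u => //; apply/seteqP; split=> [[x y] /= uyx|[x y] Bxy].
  apply: contrapT => nBxy.
  have nB : nbhs (x, y) (~` sval B).
    by apply: open_nbhs_nbhs; split => //; exact/closed_openC/(svalP B).
  (* Local strictness is applied to the complement of [B], so the strict pair found stays outside
     [B]. *)
  have [|[x' y'] nB' [/= _ /negP]] :=
    U_locally_strict (Phi u) _ x y uyx (~` sval B) nB; first by exists u.
  rewrite /Phi/= -ltNge => uyx'.
  (* If [v] is within half the gap of [u] at both points, then [v] still ranks [x'] above [y']. *)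
  have e0 : 0 < (u x' - u y') / 2 by lra.
  have cK : compact [set x'; y'] by apply: compactU; exact: compact_set1.
  have [|v [B' [uv mB' B'v]]] := clu _ (miss [set (x', y')])
    (nbhs_compact_convergence _ _ _ u _ cK e0).
    apply: nbhs_miss; first exact: compact_set1.
    by rewrite /miss/= setIC; apply/disjoints_subset => _ ->.
  suff B'xy : sval B' (x', y') by have /seteqP[/(_ (x', y')) + _] := mB'; apply.
  rewrite B'v /Phi/=.
  have := uv x' (or_introl erefl); have := uv y' (or_intror erefl).
  rewrite !ltr_norml => /andP[? ?] /andP[? ?]; lra.
rewrite /Phi/= leNgt; apply/negP => uxy.
have [K xK cK] := locally_compact_nbhs _ X_locally_compact x.
have [L yL cL] := locally_compact_nbhs _ X_locally_compact y.
have cKL : compact (K `|` L) by exact: compactU.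
(* A quarter of the gap: moving from [x] to [a] and from [u] to [v] each costs less than [e], and
   likewise at [y] and [b], whence [v a < u x + 2 e = u y - 2 e < v b]. *)
pose e := (u y - u x) / 4; have e0 : 0 < e by rewrite /e; lra.
pose G1 := [set z | K z /\ u z < u x + e].
pose G2 := [set z | L z /\ u y - e < u z].
have xG1 : nbhs x G1.
  apply: filterI => //.
  by apply: (@cvgr_lt _ _ _ _ u (u x) (U_continuous u Uu x)); rewrite /e; lra.
have yG2 : nbhs y G2.
  apply: filterI => //.
  by apply: (@cvgr_gt _ _ _ _ u (u y) (U_continuous u Uu y)); rewrite /e; lra.
(* The interior is taken because [K] and [L], hence [G1] and [G2], need not be open. *)
have [|v [B' [uv [[a b] [B'ab /interior_subset[/= [Ka ua] [Lb ub]]]] B'v]]] :=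
  clu _ (hit (interior (G1 `*` G2))) (nbhs_compact_convergence _ _ _ u _ cKL e0).
  apply: nbhs_hit; first exact: open_interior.
  by exists (x, y); split => //; exists (G1, G2).
move: B'ab; rewrite B'v /Phi/=.
have := uv a (or_introl Ka); have := uv b (or_intror Lb).
rewrite !ltr_norml => /andP[? ?] /andP[? ?].
have eE : e * 4 = u y - u x by rewrite /e; lra.
by apply/negP; rewrite -ltNge; clearbody e; lra.
Qed.
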